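(* Let $L$ be a finite-dimensional Lie superalgebra over a field $\mathbb{F}$ of characteristic different from $2,3$, and let $$0\longrightarrow R\longrightarrow F\stackrel{\pi}{\longrightarrow} L\longrightarrow 0$$ be a free presentation of $L$ (that is, an extension of $L$ with $F$ a free Lie superalgebra). Then, up to isomorphisms of extensions, the stem deformations of this free presentation exhaust all the maximal stem extensions of $L$. That is: every stem deformation $0\to R/X\to F/X\stackrel{\pi}{\to} L\to 0$ of the free presentation is a maximal stem extension of $L$, and every maximal stem extension of $L$ is isomorphic, as an extension of $L$, to a stem deformation of the free presentation.
   Context: All (super)spaces and (super)algebras are over $\mathbb{F}$. A superspace is a $\mathbb{Z}_2$-graded vector space; subsuperspaces, subalgebras and ideals are $\mathbb{Z}_2$-graded, and homomorphisms of Lie superalgebras are even linear maps preserving the bracket. The superdimension of a finite-dimensional superspace $V$ is $\mathrm{sdim}V=(\dim V_{\bar 0},\dim V_{\bar 1})$, and pairs are partially ordered by $(m,n)\le(k,l)\iff m\le k$ and $n\le l$. An extension of a Lie superalgebra $L$ by $A$ is a short exact sequence of Lie superalgebra homomorphisms $0\to A\to B\stackrel{\beta}{\to}L\to0$; $A$ is identified with an ideal of $B$. A homomorphism of extensions of $L$ from $0\to A\to B\stackrel{\beta}{\to}L\to 0$ to $0\to C\to D\stackrel{\gamma}{\to}L\to 0$ is a Lie superalgebra homomorphism $f:B\to D$ with $\gamma\circ f=\beta$ (it then maps $A$ into $C$); it is an isomorphism of extensions if $f$ is bijective. A stem extension of $L$ is an extension $0\to S\to T\to L\to 0$ with $S\subset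 \mathrm{Z}(T)$ (central) and $S\subset[T,T]$. For finite-dimensional $L$, the kernel $S$ of any stem extension is finite-dimensional, with superdimension bounded in terms of $L$. A stem extension is called maximal if, among all the stem extensions of $L$, its kernel $S$ is of maximal superdimension with respect to the partial order on pairs given by $(m,n)\le(k,l)\iff m\le k$ and $n\le l$. A stem denominator of an extension $0\to A\to B\stackrel{\beta}{\to}L\to0$ is a subsuperspace $X$ with $[A,B]\subset X\subset A$ such that $A/[A,B]=(A\cap[B,B])/[A,B]\oplus X/[A,B]$ (such an $X$ is an ideal of $B$). For a stem denominator $X$, the induced extension $0\to A/X\to B/X\stackrel{\beta}{\to}L\to0$ (where $\beta$ also denotes the induced map) is called a stem deformation of the extension. *)

(* Defs.v *)
From HB Require Import structures.
From mathcomp Require Import all_boot all_algebra.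
From mathcomp Require Import ring_quotient.
From mathcomp Require Import boolp classical_sets.

Set Implicit Arguments.
Unset Strict Implicit.
Unset Printing Implicit Defensive.

Import GRing.Theory.
Local Open Scope ring_scope.
Local Open Scope classical_set_scope.
Local Open Scope quotient_scope.

(* Lets [A x] be written when [A] coerces to a set. *)
Identity Coercion fun_of_set : set >-> Funclass.

Definition is_linsub (K : fieldType) (V : lmodType K) (A : set V) : Prop :=
  A 0 /\ forall (a : K) (x y : V), A x -> A y -> A (a *: x + y).

Definition linspan (K : fieldType) (V : lmodType K) (A : set V) : set V :=
  smallest (@is_linsub K V) A.

Definition has_dim (K : fieldType) (V : lmodType K) (A : set V) (n : nat) : Prop :=
  exists e : 'I_n -> V,
    [/\ forall i, A (e i),
        forall c : 'I_n -> K, \sum_i c i *: e i = 0 -> forall i, c i = 0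
      & forall x, A x -> exists c : 'I_n -> K, x = \sum_i c i *: e i].

Definition direct_sum (K : fieldType) (V : lmodType K) (W A B : set V) : Prop :=
  W = [set a + b | a in A & b in B] /\ A `&` B = [set 0].

(* The grading group Z_2 is [bool]: [homog false] is the even part, [homog true]
   the odd part, and addition in Z_2 is [addb]. *)
HB.mixin Record Lmodule_isSuperspace (K : fieldType) V of GRing.Lmodule K V := {
  homog : bool -> set V;
  homog_linsub : forall a, is_linsub (homog a);
  homog_direct : direct_sum [set: V] (homog false) (homog true) }.

#[short(type="superspaceType")]
HB.structure Definition Superspace (K : fieldType) :=
  {V of GRing.Lmodule K V & Lmodule_isSuperspace K V}.

(* These axioms are the usual ones in characteristic different from 2 and 3. *)
HB.mixin Record Superspace_isLieSuper (K : fieldType) L of Superspace K L := {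
  brk : L -> L -> L;
  brk_linearl : forall y, linear (fun x => brk x y);
  brk_linearr : forall x, linear (brk x);
  brk_homog : forall a b x y,
    homog a x -> homog b y -> homog (a (+) b) (brk x y);
  brk_anti : forall a b x y, homog a x -> homog b y ->
    brk x y = - ((-1) ^+ (a && b) *: brk y x);
  brk_jacobi : forall a b c x y z, homog a x -> homog b y -> homog c z ->
    brk x (brk y z) = brk (brk x y) z + (-1) ^+ (a && b) *: brk y (brk x z) }.

#[short(type="lieSuperType")]
HB.structure Definition LieSuper (K : fieldType) :=
  {L of Superspace K L & Superspace_isLieSuper K L}.

Arguments brk_homog {K s} [a b x y].
Arguments brk_anti {K s} [a b x y].
Arguments brk_jacobi {K s} [a b c x y z].

Record lieHom (K : fieldType) (L M : lieSuperType K) := LieHom {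
  lieHom_fun :> {linear L -> M};
  lieHom_even : forall a x, homog a x -> homog a (lieHom_fun x);
  lieHom_brk : forall x y,
    lieHom_fun (brk x y) = brk (lieHom_fun x) (lieHom_fun y) }.

Record subsuper (K : fieldType) (V : superspaceType K) := SubSuper {
  subsuper_set :> set V;
  subsuper_linsub : is_linsub subsuper_set;
  subsuper_graded : forall x, subsuper_set x ->
    exists x0 x1, [/\ subsuper_set x0, subsuper_set x1,
                      homog false x0, homog true x1 & x = x0 + x1] }.

Record lieIdeal (K : fieldType) (L : lieSuperType K) := LieIdeal {
  lieIdeal_sub :> subsuper L;
  lieIdeal_l : forall x y,
    lieIdeal_sub y -> lieIdeal_sub (brk x y);
  lieIdeal_r : forall x y,
    lieIdeal_sub x -> lieIdeal_sub (brk x y) }.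

Definition findim (K : fieldType) (V : lmodType K) : Prop :=
  exists n, has_dim [set: V] n.

Definition has_sdim (K : fieldType) (V : superspaceType K) (d : nat * nat) : Prop :=
  has_dim (homog false : set V) d.1 /\ has_dim (homog true : set V) d.2.

Definition sdim_le (d e : nat * nat) : bool := (d.1 <= e.1)%N && (d.2 <= e.2)%N.

Definition centre (K : fieldType) (L : lieSuperType K) : set L :=
  [set x | forall y, brk x y = 0].

Definition brkset (K : fieldType) (L : lieSuperType K) (A B : set L) : set L :=
  linspan [set brk x y | x in A & y in B].

Section Basics.
Variable K : fieldType.

Section Linsub.
Variables (V : lmodType K) (A : set V).
Hypothesis hA : is_linsub A.
Lemma linsub0 : A 0. Proof. by case: hA. Qed.
Lemma linsubD x y : A x -> A y -> A (x + y).
Proof. by move=> hx hy; rewrite -[x]scale1r; case: hA => _; apply. Qed.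
Lemma linsubZ a x : A x -> A (a *: x).
Proof. by move=> hx; rewrite -[_ *: _]addr0; case: hA => h0; apply. Qed.
Lemma linsubN x : A x -> A (- x).
Proof. by move=> hx; rewrite -scaleN1r; apply: linsubZ. Qed.
Lemma linsubB x y : A x -> A y -> A (x - y).
Proof. by move=> hx hy; apply: linsubD => //; apply: linsubN. Qed.
End Linsub.

Lemma linspan_linsub (V : lmodType K) (A : set V) : is_linsub (linspan A).
Proof.
split=> [B [[]] //|a x y hx hy B [hB AB]].
by case: (hB) => _; apply; [apply: hx|apply: hy].
Qed.

Lemma homog_dec (V : superspaceType K) (x : V) :
  exists x0 x1, [/\ homog false x0, homog true x1 & x = x0 + x1].
Proof.
have [+ _] := @homog_direct K V.
move/seteqP=> [/(_ x I) [x0 h0 [x1 h1 <-]] _].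
by exists x0, x1.
Qed.

Lemma homog_uniq (V : superspaceType K) (x0 x1 y0 y1 : V) :
  homog false x0 -> homog true x1 -> homog false y0 -> homog true y1 ->
  x0 + x1 = y0 + y1 -> x0 = y0 /\ x1 = y1.
Proof.
move=> hx0 hx1 hy0 hy1 e.
have e' : x0 - y0 = y1 - x1.
  by apply/eqP; rewrite subr_eq addrAC eq_sym subr_eq addrC -e addrC.
have [_ /seteqP[+ _]] := @homog_direct K V.
move=> /(_ (x0 - y0)) h.
have /eqP : x0 - y0 = 0.
  apply: h; split; first exact: (linsubB (homog_linsub false)).
  by rewrite e'; apply: (linsubB (homog_linsub true)).
rewrite subr_eq0 => /eqP hx; split=> //.
by move: e; rewrite hx => /addrI.
Qed.

Section LieBasics.
Variable L : lieSuperType K.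
Lemma brkDl (x y z : L) : brk (x + y) z = brk x z + brk y z.
Proof. by have := @brk_linearl K L z 1 x y; rewrite !scale1r. Qed.
Lemma brkDr (x y z : L) : brk x (y + z) = brk x y + brk x z.
Proof. by have := @brk_linearr K L x 1 y z; rewrite !scale1r. Qed.
Lemma brk0l (z : L) : brk 0 z = 0.
Proof. by apply: (addrI (brk 0 z)); rewrite -brkDl !addr0. Qed.
Lemma brk0r (z : L) : brk z 0 = 0.
Proof. by apply: (addrI (brk z 0)); rewrite -brkDr !addr0. Qed.
Lemma brkZl a (x z : L) : brk (a *: x) z = a *: brk x z.
Proof. by have := @brk_linearl K L z a x 0; rewrite !addr0 brk0l addr0. Qed.
Lemma brkZr a (x z : L) : brk z (a *: x) = a *: brk z x.
Proof. by have := @brk_linearr K L z a x 0; rewrite !addr0 brk0r addr0. Qed.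
Lemma brkNl (x z : L) : brk (- x) z = - brk x z.
Proof. by rewrite -scaleN1r brkZl scaleN1r. Qed.
Lemma brkNr (x z : L) : brk z (- x) = - brk z x.
Proof. by rewrite -scaleN1r brkZr scaleN1r. Qed.
End LieBasics.

Lemma full_linsub (V : superspaceType K) : is_linsub [set: V].
Proof. by []. Qed.
Lemma full_graded (V : superspaceType K) (x : V) : [set: V] x ->
  exists x0 x1, [/\ [set: V] x0, [set: V] x1, homog false x0, homog true x1
                  & x = x0 + x1].
Proof. by move=> _; have [x0 [x1 []]] := homog_dec x; exists x0, x1. Qed.
Definition subfull (V : superspaceType K) : subsuper V :=
  SubSuper (@full_linsub V) (@full_graded V).

Lemma brkset_graded (L : lieSuperType K) (A B : subsuper L) (x : L) :
  brkset A B x ->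
  exists x0 x1, [/\ brkset A B x0, brkset A B x1, homog false x0, homog true x1
                  & x = x0 + x1].
Proof.
have lin := linspan_linsub [set brk x y | x in A & y in B].
have gen u v : A u -> B v -> brkset A B (brk u v).
  by move=> hu hv C [_]; apply; exists u => //; exists v.
move=> /(_ [set x | exists x0 x1, [/\ brkset A B x0, brkset A B x1,
  homog false x0, homog true x1 & x = x0 + x1]]); apply; split.
  split.
    exists 0, 0; rewrite addr0; split=> //; try exact: (linsub0 lin);
      exact: (linsub0 (homog_linsub _)).
  move=> a u v [u0 [u1 [? ? ? ? ->]]] [v0 [v1 [? ? ? ? ->]]].
  exists (a *: u0 + v0), (a *: u1 + v1); split.
  - by apply: (linsubD lin) => //; apply: (linsubZ lin).
  - by apply: (linsubD lin) => //; apply: (linsubZ lin).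
  - by case: (@homog_linsub K L false) => _; apply.
  - by case: (@homog_linsub K L true) => _; apply.
  - by rewrite scalerDr addrACA.
move=> _ [u hu [v hv <-]].
have [u0 [u1 [Au0 Au1 hu0 hu1 ->]]] := subsuper_graded hu.
have [v0 [v1 [Bv0 Bv1 hv0 hv1 ->]]] := subsuper_graded hv.
exists (brk u0 v0 + brk u1 v1), (brk u0 v1 + brk u1 v0); split.
- by apply: (linsubD lin); apply: gen.
- by apply: (linsubD lin); apply: gen.
- by have := linsubD (homog_linsub false) (brk_homog hu0 hv0) (brk_homog hu1 hv1).
- by have := linsubD (homog_linsub true) (brk_homog hu0 hv1) (brk_homog hu1 hv0).
- by rewrite brkDl !brkDr (addrC (brk u1 v0)) addrACA.
Qed.

Definition subbrk (L : lieSuperType K) (A B : subsuper L) : subsuper L :=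
  SubSuper (linspan_linsub _) (@brkset_graded L A B).

End Basics.

Section QuotientSuperspace.
Variables (K : fieldType) (V : superspaceType K) (U : subsuper V).

Definition sspred : {pred V} := [pred x | x \in (U : set V)].

Lemma sspred_zmod : zmod_closed sspred.
Proof.
have hU := subsuper_linsub U.
by split=> [|x y]; rewrite !inE; [exact: linsub0|exact: linsubB].
Qed.
HB.instance Definition _ := GRing.isZmodClosed.Build V sspred sspred_zmod.

Definition squot := Quotient.quot sspred.
HB.instance Definition _ := GRing.Zmodule.on squot.
HB.instance Definition _ := Quotient.on squot.

Definition qpi : V -> squot := \pi_squot.

Lemma qpi_surj (u : squot) : exists x, qpi x = u.
Proof. by exists (repr u); rewrite /qpi reprK. Qed.

Lemma qpi_eq x y : (qpi x = qpi y) <-> U (x - y).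
Proof.
rewrite /qpi; split.
  by move=> /eqP; rewrite -Quotient.idealrBE inE.
by move=> h; apply/eqP; rewrite -Quotient.idealrBE inE.
Qed.

Lemma qpiB x y : qpi (x - y) = qpi x - qpi y.
Proof. exact: (@pi_is_zmod_morphism V _ _ (Quotient.quot sspred)). Qed.
Lemma qpi0 : qpi 0 = 0.
Proof. by rewrite -[X in qpi X](subrr 0) qpiB subrr. Qed.
Lemma qpiN x : qpi (- x) = - qpi x.
Proof. by rewrite -[- x]sub0r qpiB qpi0 sub0r. Qed.
Lemma qpiD x y : qpi (x + y) = qpi x + qpi y.
Proof. by rewrite -[y in LHS]opprK qpiB qpiN opprK. Qed.

Definition qscale (a : K) (u : squot) : squot := qpi (a *: repr u).

Lemma qpiZ a x : qpi (a *: x) = qscale a (qpi x).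
Proof.
apply/qpi_eq; rewrite -scalerBr; apply: (linsubZ (subsuper_linsub U)).
by apply/qpi_eq; rewrite {2}/qpi reprK.
Qed.

Lemma qscaleA a b u : qscale a (qscale b u) = qscale (a * b) u.
Proof. by have [x <-] := qpi_surj u; rewrite -!qpiZ scalerA. Qed.
Lemma qscale1 : left_id 1 qscale.
Proof. by move=> u; have [x <-] := qpi_surj u; rewrite -!qpiZ scale1r. Qed.
Lemma qscaleDr : right_distributive qscale +%R.
Proof.
move=> a u v; have [x <-] := qpi_surj u; have [y <-] := qpi_surj v.
by rewrite -qpiD -!qpiZ -qpiD scalerDr.
Qed.
Lemma qscaleDl u : {morph qscale^~ u : a b / a + b}.
Proof.
by move=> a b /=; have [x <-] := qpi_surj u; rewrite -!qpiZ -qpiD scalerDl.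
Qed.
HB.instance Definition _ := GRing.Zmodule_isLmodule.Build K squot
  qscaleA qscale1 qscaleDr qscaleDl.

Lemma qpi_linear : linear qpi.
Proof. by move=> a x y; rewrite qpiD qpiZ. Qed.
HB.instance Definition _ := GRing.isLinear.Build K V squot _ qpi qpi_linear.

Definition qhomog (a : bool) : set squot := qpi @` homog a.

Lemma qhomog_linsub a : is_linsub (qhomog a).
Proof.
have hL := @homog_linsub K V a.
split; first by exists 0; [exact: linsub0|rewrite qpi0].
move=> c _ _ [x hx <-] [y hy <-]; exists (c *: x + y); last by rewrite linearP.
by apply: linsubD => //; apply: linsubZ.
Qed.

Lemma qhomog_direct : direct_sum [set: squot] (qhomog false) (qhomog true).
Proof.
split; apply/seteqP; split => //.
- move=> u _; have [x <-] := qpi_surj u.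
  have [x0 [x1 [h0 h1 ->]]] := homog_dec x.
  exists (qpi x0); first by exists x0.
  by exists (qpi x1); [exists x1|rewrite qpiD].
- move=> u [[x hx <-] [y hy /qpi_eq hyx]].
  have [z0 [z1 [U0 U1 h0 h1 e]]] := subsuper_graded hyx.
  have hx' := linsubN (homog_linsub false) hx.
  have e' : - x + y = z0 + z1 by rewrite -e addrC.
  have [e0 _] := homog_uniq hx' hy h0 h1 e'.
  rewrite /= -qpi0; apply/qpi_eq; rewrite subr0 -[x]opprK e0.
  exact: (linsubN (subsuper_linsub U)).
- by move=> _ ->; split; apply: linsub0; exact: qhomog_linsub.
Qed.
HB.instance Definition _ := Lmodule_isSuperspace.Build K squot
  qhomog_linsub qhomog_direct.

End QuotientSuperspace.

Section QuotientLie.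
Variables (K : fieldType) (L : lieSuperType K) (I : lieIdeal L).

Definition lquot := squot I.
HB.instance Definition _ := Superspace.on lquot.

Definition lpi : {linear L -> lquot} := @qpi K L I.

Lemma lpi_surj (u : lquot) : exists x, lpi x = u.
Proof. exact: qpi_surj. Qed.

Lemma lpi_eq x y : lpi x = lpi y <-> I (x - y).
Proof. exact: qpi_eq. Qed.

Definition qbrk (u v : lquot) : lquot := lpi (brk (repr u) (repr v)).

Lemma lpi_brk x y : lpi (brk x y) = qbrk (lpi x) (lpi y).
Proof.
have rK (z : L) : I (z - repr (lpi z)) by apply/lpi_eq; rewrite /= {2}/qpi reprK.
apply/lpi_eq.
have -> : brk x y - brk (repr (lpi x)) (repr (lpi y)) =
  brk (x - repr (lpi x)) y + brk (repr (lpi x)) (y - repr (lpi y)).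
  by rewrite brkDl brkDr brkNl brkNr addrA subrK.
apply: (linsubD (subsuper_linsub I)).
  exact/lieIdeal_r/rK.
exact/lieIdeal_l/rK.
Qed.

Lemma qbrk_linearl v : linear (fun u => qbrk u v).
Proof.
move=> a u w; have [x <-] := lpi_surj u; have [y <-] := lpi_surj v.
have [z <-] := lpi_surj w.
by rewrite -linearP -!lpi_brk -linearP brkDl brkZl.
Qed.
Lemma qbrk_linearr u : linear (qbrk u).
Proof.
move=> a v w; have [x <-] := lpi_surj u; have [y <-] := lpi_surj v.
have [z <-] := lpi_surj w.
by rewrite -linearP -!lpi_brk -linearP brkDr brkZr.
Qed.
Lemma qbrk_homog a b (u v : lquot) :
  homog a u -> homog b v -> homog (a (+) b) (qbrk u v).
Proof.
move=> [x hx <-] [y hy <-]; exists (brk x y); first exact: brk_homog.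
exact: lpi_brk.
Qed.
Lemma qbrk_anti a b (u v : lquot) : homog a u -> homog b v ->
  qbrk u v = - ((-1) ^+ (a && b) *: qbrk v u).
Proof.
move=> [x hx <-] [y hy <-]; rewrite -!lpi_brk -linearZ -linearN.
by rewrite (brk_anti hx hy).
Qed.
Lemma qbrk_jacobi a b c (u v w : lquot) :
  homog a u -> homog b v -> homog c w ->
  qbrk u (qbrk v w) = qbrk (qbrk u v) w + (-1) ^+ (a && b) *: qbrk v (qbrk u w).
Proof.
move=> [x hx <-] [y hy <-] [z hz <-].
rewrite -(lpi_brk y z) -(lpi_brk x y) -(lpi_brk x z) -(lpi_brk x (brk y z)).
rewrite -(lpi_brk (brk x y)) -(lpi_brk y (brk x z)) -linearZ -linearD.
by rewrite (brk_jacobi hx hy hz).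
Qed.
HB.instance Definition _ := Superspace_isLieSuper.Build K lquot
  qbrk_linearl qbrk_linearr qbrk_homog qbrk_anti qbrk_jacobi.

Lemma lpi_even a x : homog a x -> homog a (lpi x).
Proof. by move=> hx; exists x. Qed.

Definition lquot_pi : lieHom L lquot := LieHom lpi_even lpi_brk.

Variables (M : lieSuperType K) (f : lieHom L M).
Hypothesis fI : forall x, I x -> f x = 0.

Definition lquot_lift_fun (u : lquot) : M := f (repr u).

Lemma lquot_liftE x : lquot_lift_fun (lpi x) = f x.
Proof.
apply/eqP; rewrite -subr_eq0 -linearB; apply/eqP/fI/lpi_eq.
by rewrite /= {1}/qpi reprK.
Qed.

Lemma lquot_lift_linear : linear lquot_lift_fun.
Proof.
move=> a u v; have [x <-] := lpi_surj u; have [y <-] := lpi_surj v.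
by rewrite -linearP !lquot_liftE linearP.
Qed.
HB.instance Definition _ :=
  GRing.isLinear.Build K lquot M _ lquot_lift_fun lquot_lift_linear.

Lemma lquot_lift_even a (u : lquot) : homog a u -> homog a (lquot_lift_fun u).
Proof. by move=> [x hx <-]; rewrite lquot_liftE; apply: lieHom_even. Qed.
Lemma lquot_lift_brk (u v : lquot) :
  lquot_lift_fun (brk u v) = brk (lquot_lift_fun u) (lquot_lift_fun v).
Proof.
have [x <-] := lpi_surj u; have [y <-] := lpi_surj v.
by rewrite -(lieHom_brk lquot_pi) !lquot_liftE lieHom_brk.
Qed.

Definition lquot_lift : lieHom lquot M :=
  @LieHom K lquot M lquot_lift_fun lquot_lift_even lquot_lift_brk.

End QuotientLie.

Section Comp.
Variables (K : fieldType) (L M N : lieSuperType K).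
Variables (g : lieHom M N) (f : lieHom L M).
Lemma lieComp_even a x : homog a x -> homog a ((g \o f) x).
Proof. by move=> hx; do 2!apply: lieHom_even. Qed.
Lemma lieComp_brk x y : (g \o f) (brk x y) = brk ((g \o f) x) ((g \o f) y).
Proof. by rewrite /= !lieHom_brk. Qed.
Definition lieComp : lieHom L N :=
  @LieHom K L N (g \o f : {linear L -> N}) lieComp_even lieComp_brk.
End Comp.

Section ImageKernel.
Variables (K : fieldType) (L M : lieSuperType K) (f : lieHom L M).

Lemma range_linsub : is_linsub (range f).
Proof.
split; first by exists 0; rewrite ?linear0.
by move=> a _ _ [x _ <-] [y _ <-]; exists (a *: x + y); rewrite ?linearP.
Qed.
Lemma range_graded y : range f y ->
  exists y0 y1, [/\ range f y0, range f y1, homog false y0, homog true y1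
                  & y = y0 + y1].
Proof.
move=> [x _ <-]; have [x0 [x1 [h0 h1 ->]]] := homog_dec x.
exists (f x0), (f x1); split; [by exists x0|by exists x1|..].
- exact: lieHom_even.
- exact: lieHom_even.
- by rewrite linearD.
Qed.
Definition subrange : subsuper M := SubSuper range_linsub range_graded.

Variable J : lieIdeal M.

Lemma preim_linsub : is_linsub (f @^-1` J).
Proof.
have hJ := subsuper_linsub J.
split; first by rewrite /preimage /= linear0; exact: linsub0.
move=> a x y hx hy; rewrite /preimage /= linearP.
by apply: linsubD => //; apply: linsubZ.
Qed.
Lemma preim_graded x : (f @^-1` J) x ->
  exists x0 x1, [/\ (f @^-1` J) x0, (f @^-1` J) x1, homog false x0, homog true x1
                  & x = x0 + x1].
Proof.
move=> hx; have [x0 [x1 [h0 h1 e]]] := homog_dec x.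
have [y0 [y1 [J0 J1 k0 k1 e']]] := subsuper_graded hx.
have e2 : f x0 + f x1 = y0 + y1 by rewrite -linearD -e.
have [q0 q1] := homog_uniq (lieHom_even f h0) (lieHom_even f h1) k0 k1 e2.
by exists x0, x1; rewrite /preimage /= q0 q1.
Qed.
Definition subpreim : subsuper L := SubSuper preim_linsub preim_graded.
Lemma preim_l x y : subpreim y -> subpreim (brk x y).
Proof. by rewrite /= /preimage /= lieHom_brk; apply: lieIdeal_l. Qed.
Lemma preim_r x y : subpreim x -> subpreim (brk x y).
Proof. by rewrite /= /preimage /= lieHom_brk; apply: lieIdeal_r. Qed.
Definition lieIdeal_preim : lieIdeal L := LieIdeal preim_l preim_r.

End ImageKernel.

(* Freeness on a Z_2-graded set [X] with parity map [par]. *)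
Definition is_free_lie (K : fieldType) (F : lieSuperType K) : Prop :=
  exists (X : Type) (par : X -> bool) (i : X -> F),
    (forall x, homog (par x) (i x)) /\
    forall (M : lieSuperType K) (g : X -> M), (forall x, homog (par x) (g x)) ->
      (exists h : lieHom F M, forall x, h (i x) = g x) /\
      (forall h h' : lieHom F M, (forall x, h (i x) = g x) ->
         (forall x, h' (i x) = g x) -> h =1 h').

Record extension (K : fieldType) (L : lieSuperType K) := Extension {
  ext_ker : lieSuperType K;
  ext_mid : lieSuperType K;
  ext_inj : lieHom ext_ker ext_mid;
  ext_proj : lieHom ext_mid L;
  ext_inj_injective : injective ext_inj;
  ext_proj_surj : forall y, exists x, ext_proj x = y;
  ext_exact : forall x, ext_proj x = 0 <-> range ext_inj x }.

Section Extensions.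
Variables (K : fieldType) (L : lieSuperType K).
Implicit Types (E T : extension L).

(* The kernel term of [E], seen inside the middle term. *)
Definition ext_sub E : subsuper (ext_mid E) := subrange (ext_inj E).

Definition is_ext_hom E T (f : lieHom (ext_mid E) (ext_mid T)) : Prop :=
  forall x, ext_proj T (f x) = ext_proj E x.

Definition ext_iso E T : Prop :=
  exists f : lieHom (ext_mid E) (ext_mid T), is_ext_hom f /\ bijective f.

Definition is_stem E : Prop :=
  ext_sub E `<=` @centre K (ext_mid E) /\
  ext_sub E `<=` brkset [set: ext_mid E] [set: ext_mid E].

(* Maximality of the superdimension is maximality for a partial order: no stem
   extension has a kernel of strictly larger superdimension. *)
Definition is_maximal_stem E : Prop :=
  is_stem E /\
  exists d, has_sdim (ext_ker E) d /\
    forall T d', is_stem T -> has_sdim (ext_ker T) d' -> sdim_le d d' -> d' = d.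

Definition stem_denominator E (X : subsuper (ext_mid E)) : Prop :=
  let A := ext_sub E in
  let AB := subbrk A (subfull (ext_mid E)) in
  let pi := @qpi K (ext_mid E) AB in
  [/\ AB `<=` X, X `<=` A
    & direct_sum (pi @` A)
        (pi @` (A `&` brkset [set: ext_mid E] [set: ext_mid E])) (pi @` X)].

Section Deformation.
Variables (E : extension L) (X : subsuper (ext_mid E)).
Hypothesis hX : stem_denominator X.

Lemma stem_denominator_r x y : X x -> X (brk x y).
Proof.
case: hX => hAB hA _ hx; apply: hAB => C [_]; apply.
by exists x; [exact: hA|exists y].
Qed.

Lemma stem_denominator_l x y : X y -> X (brk x y).
Proof.
have lin := subsuper_linsub X.
move=> /subsuper_graded[y0 [y1 [X0 X1 k0 k1 ->]]].
have [x0 [x1 [h0 h1 ->]]] := homog_dec x.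
rewrite brkDr !brkDl (brk_anti h0 k0) (brk_anti h1 k0).
rewrite (brk_anti h0 k1) (brk_anti h1 k1).
by do 2!(apply: (linsubD lin)); apply: (linsubN lin); apply: (linsubZ lin);
  exact: stem_denominator_r.
Qed.

Definition stem_ideal : lieIdeal (ext_mid E) :=
  LieIdeal stem_denominator_l stem_denominator_r.

(* [A/X], where [X] is read inside the kernel term [A]. *)
Definition deform_ker : lieSuperType K := lquot (lieIdeal_preim (ext_inj E) stem_ideal).
Definition deform_mid : lieSuperType K := lquot stem_ideal.

Lemma deform_inj0 a : lieIdeal_preim (ext_inj E) stem_ideal a ->
  lieComp (lquot_pi stem_ideal) (ext_inj E) a = 0.
Proof.
move=> ha; have <- := linear0 (lquot_pi stem_ideal).
by apply/lpi_eq; rewrite subr0.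
Qed.

Lemma deform_proj0 x : stem_ideal x -> ext_proj E x = 0.
Proof. by case: hX => _ hA _ /hA hx; apply/ext_exact. Qed.

Definition deform_inj : lieHom deform_ker deform_mid := lquot_lift deform_inj0.
Definition deform_proj : lieHom deform_mid L := lquot_lift deform_proj0.

Lemma deform_inj_injective : injective deform_inj.
Proof.
move=> u v; have [x <-] := lpi_surj u; have [y <-] := lpi_surj v.
rewrite /= !(lquot_liftE deform_inj0) /= => /lpi_eq h.
by apply/lpi_eq; rewrite /= /preimage /= linearB.
Qed.

Lemma deform_proj_surj y : exists u, deform_proj u = y.
Proof.
have [x <-] := ext_proj_surj E y; exists (lpi stem_ideal x).
exact: (lquot_liftE deform_proj0).
Qed.

Lemma deform_exact u : deform_proj u = 0 <-> range deform_inj u.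
Proof.
have [x <-] := lpi_surj u; rewrite /= (lquot_liftE deform_proj0); split.
  move=> /ext_exact[a _ <-]; exists (lpi _ a) => //.
  exact: (lquot_liftE deform_inj0).
move=> [v _]; have [a <-] := lpi_surj v.
rewrite /= (lquot_liftE deform_inj0) /= => /lpi_eq /deform_proj0.
rewrite linearB => /eqP; rewrite subr_eq0 => /eqP <-.
by apply/ext_exact; exists a.
Qed.

Definition stem_deformation : extension L :=
  Extension deform_inj_injective deform_proj_surj deform_exact.

End Deformation.
End Extensions.

(* Main.v *)
Require Import Defs.
From HB Require Import structures.
From mathcomp Require Import all_boot all_algebra.
From mathcomp Require Import boolp classical_sets.

(** Write the free presentation as [R -> F -> L]. The point is that the graded
    space M = (R `&` [F, F]) / [F, R] controls every stem extension [S -> T -> L].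

    Since [F] is free, the projection of [F] lifts to a homomorphism of extensions
    f from [F] to [T] ([free_ext_lift]). As [S] is central, brackets in [T] depend
    only on the images of their arguments in [L], so f maps [F, F] onto [T, T],
    which contains [S]; hence f maps R `&` [F, F] onto [S]
    ([stem_kernel_image]), and f is onto. Centrality of [S] also makes f vanish on
    [F, R] ([stem_hom_commut0]). So [S] is a quotient of M, compatibly with parity.

    For a stem denominator X, the decomposition R / [F, R] = M + X / [F, R] says
    exactly that R / X is a copy of M and that F / X is a stem extension
    ([stem_deformation_stem]); its kernel is finite dimensional
    ([stem_has_sdim]), because the derived algebra of a central extension of [L] is
    spanned by the brackets of lifts of a basis of [L]. The superdimension of
    R / X is thus an upper bound for that of every [S] ([stem_sdim_le]): stem
    deformations are maximal, indeed of greatest superdimension.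

    Conversely let T be maximal. A stem denominator X exists, because graded
    subspaces have graded complements ([graded_complement], by Zorn's lemma, as R
    need not be finite dimensional). Comparing with F / X, the superdimension of
    [S] equals that of M, so the surjection from M onto [S] is injective
    ([stem_sdim_inj]). This is what makes the kernel of f meet R `&` [F, F] only
    in [F, R]; the kernel of f is then itself a stem denominator, and T is the
    quotient of [F] by it ([stem_hom_kernel_iso]). *)

Set Implicit Arguments.
Unset Strict Implicit.
Unset Printing Implicit Defensive.

Import GRing.Theory.
Local Open Scope ring_scope.
Local Open Scope classical_set_scope.

(** * Dimension of subspaces *)

Section Dimension.
Variable K : fieldType.

Definition indep (V : lmodType K) n (u : 'I_n -> V) : Prop :=
  forall c : 'I_n -> K, \sum_i c i *: u i = 0 -> forall i, c i = 0.

Definition family_span (V : lmodType K) (I : finType) (e : I -> V) : set V :=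
  [set x | exists c : I -> K, x = \sum_i c i *: e i].

Definition family_cons (V : lmodType K) n (x : V) (u : 'I_n -> V) (i : 'I_n.+1) : V :=
  oapp u x (unlift ord0 i).

Lemma linear_comb (V W : lmodType K) (f : {linear V -> W}) (I : finType)
    (c : I -> K) (e : I -> V) : f (\sum_i c i *: e i) = \sum_i c i *: f (e i).
Proof. by rewrite linear_sum; apply: eq_bigr => i _; rewrite linearZ. Qed.

Lemma linsub_sum (V : lmodType K) (A : set V) (I : finType) (c : I -> K) (e : I -> V) :
  is_linsub A -> (forall i, A (e i)) -> A (\sum_i c i *: e i).
Proof.
move=> hA he; apply: big_ind => [|x y|i _]; first exact: linsub0.
- exact: linsubD.
- exact: linsubZ.
Qed.

Lemma linsubI (V : lmodType K) (A B : set V) :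
  is_linsub A -> is_linsub B -> is_linsub (A `&` B).
Proof.
by move=> [A0 hA] [B0 hB]; split=> // a x y [? ?] [? ?]; split; [exact: hA|exact: hB].
Qed.

Lemma linsub_image (V W : lmodType K) (f : {linear V -> W}) (A : set V) :
  is_linsub A -> is_linsub (f @` A).
Proof.
move=> [A0 hA]; split; first by exists 0; rewrite ?linear0.
by move=> a _ _ [x hx <-] [y hy <-]; exists (a *: x + y); [exact: hA|rewrite linearP].
Qed.

Lemma family_span_linsub (V : lmodType K) (I : finType) (e : I -> V) :
  is_linsub (family_span e).
Proof.
split; first by exists (fun=> 0); rewrite big1 // => i _; rewrite scale0r.
move=> a _ _ [c ->] [d ->]; exists (fun i => a * c i + d i).
by rewrite scaler_sumr -big_split; apply: eq_bigr => i _; rewrite scalerDl scalerA.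
Qed.

(** Steinitz: with too many vectors the coefficient matrix has dependent rows,
    and a dependency of the rows is one of the vectors. *)
Lemma indep_leq (V : lmodType K) n (I : finType) (u : 'I_n -> V) (e : I -> V) :
  indep u -> (forall i, family_span e (u i)) -> (n <= #|I|)%N.
Proof.
move=> hu /choice[C hC].
pose A := \matrix_(i < n, k < #|I|) C i (enum_val k).
suff : row_free A by move=> /eqP <-; exact: rank_leq_col.
rewrite -kermx_eq0; apply/eqP/row_matrixP => k; rewrite row0.
have kA a : \sum_j kermx A k j * C j a = 0.
  have /rowP/(_ (enum_rank a)) : row k (kermx A) *m A = 0.
    by rewrite -row_mul mulmx_ker row0.
  rewrite !mxE => h; rewrite -[RHS]h; apply: eq_bigr => j _.
  by rewrite !mxE enum_rankK.
apply/rowP => i; rewrite mxE [RHS]mxE; move: i; apply: hu.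
under eq_bigr => j _ do rewrite hC scaler_sumr.
rewrite exchange_big big1 //= => a _.
under eq_bigr => j _ do rewrite scalerA.
by rewrite -scaler_suml kA scale0r.
Qed.

Lemma sum_family_cons (V : lmodType K) n (x : V) (u : 'I_n -> V) (c : 'I_n.+1 -> K) :
  \sum_i c i *: family_cons x u i
    = c ord0 *: x + \sum_i c (lift ord0 i) *: u i.
Proof.
rewrite big_ord_recl /family_cons unlift_none; congr (_ + _).
by apply: eq_bigr => i _; rewrite liftK.
Qed.

Lemma indep_cons (V : lmodType K) n (x : V) (u : 'I_n -> V) :
  indep u ->
  (forall a (c : 'I_n -> K), a *: x + \sum_i c i *: u i = 0 -> a = 0) ->
  indep (family_cons x u).
Proof.
move=> hu hx c; rewrite sum_family_cons => e0.
have c0 := hx _ _ e0.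
move: e0; rewrite c0 scale0r add0r => /hu h i.
by case: (unliftP ord0 i) => [j ->|->].
Qed.

Lemma has_dim_indep_leq (V : lmodType K) (A : set V) n m (u : 'I_m -> V) :
  has_dim A n -> indep u -> (forall i, A (u i)) -> (m <= n)%N.
Proof.
move=> [e [_ _ he]] hu uA; rewrite -[n]card_ord.
by apply: (indep_leq (e := e) hu) => i; apply: he.
Qed.

(** A longest independent family in [A] is a basis of [A]. *)
Lemma has_dim_finspan (V : lmodType K) (A : set V) (I : finType) (e : I -> V) :
  is_linsub A -> A `<=` family_span e -> exists n, has_dim A n.
Proof.
move=> hA Ae.
pose P n := `[< exists u : 'I_n -> V, indep u /\ forall i, A (u i) >].
have P0 : exists n, P n.
  exists 0%N; apply/asboolP; exists (fun=> 0).
  by split=> [c _|] [].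
have Pb n : P n -> (n <= #|I|)%N.
  by move=> /asboolP[u [hu uA]]; apply: (indep_leq hu) => i; exact/Ae/uA.
case: (ex_maxnP P0 Pb) => n /asboolP[u [hu uA]] nmax.
exists n, u; split=> // x Ax; apply: contrapT => hx.
suff : P n.+1 by move=> /nmax; rewrite ltnn.
apply/asboolP; exists (family_cons x u); split.
  apply: indep_cons => // a c e0; apply: contrapT => /eqP a0; apply: hx.
  exists (fun i => - (a^-1 * c i)).
  apply: (scalerI a0); rewrite scaler_sumr.
  move/eqP: e0; rewrite addr_eq0 => /eqP ->; rewrite -sumrN; apply: eq_bigr => i _.
  by rewrite scalerA mulrN mulVKf // scaleNr.
by move=> i; rewrite /family_cons; case: unlift => /=.
Qed.

Lemma image_choice (V W I : Type) (f : V -> W) (A : set V) (g : I -> W) :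
  (forall i, (f @` A) (g i)) -> exists e : I -> V, forall i, A (e i) /\ f (e i) = g i.
Proof.
move=> h; have [|e he] := @choice I V (fun i x => A x /\ f x = g i); last by exists e.
by move=> i; have [x Ax fx] := h i; exists x.
Qed.

Lemma has_dim_image (V W : lmodType K) (f : {linear V -> W}) (A : set V) n :
  injective f -> has_dim A n <-> has_dim (f @` A) n.
Proof.
move=> finj; split.
  move=> [e [eA ei es]]; exists (f \o e); split.
  - by move=> i; exists (e i).
  - by move=> c; rewrite -linear_comb -[X in _ = X](linear0 f) => /finj; exact: ei.
  - by move=> _ [x /es[c ->] <-]; exists c; rewrite linear_comb.
move=> [g [/image_choice[e he] gi gs]]; exists e; split.
- by move=> i; have [] := he i.
- move=> c /(congr1 f); rewrite linear_comb linear0 => h; apply: gi.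
  by rewrite -[RHS]h; apply: eq_bigr => i _; have [_ ->] := he i.
- move=> x Ax; have [|c hc] := gs (f x); first by exists x.
  exists c; apply: finj; rewrite linear_comb hc.
  by apply: eq_bigr => i _; have [_ ->] := he i.
Qed.

(** In the two lemmas closing this section, [p @` M] and [q @` M] are compared
    without constructing the induced map between them. *)
Section TwoImages.
Variables (U V W : lmodType K) (M : set U) (p : {linear U -> V}) (q : {linear U -> W}).
Hypotheses (hM : is_linsub M) (pq : forall x, M x -> p x = 0 -> q x = 0).

(** [q] induces a surjection from [p @` M] onto [q @` M]: a basis of the target,
    lifted to [M] and pushed to [p @` M], stays independent. *)
Lemma image_dim_lift m : has_dim (q @` M) m ->
  exists x : 'I_m -> U, [/\ forall i, M (x i), indep (q \o x) & indep (p \o x)].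
Proof.
move=> [e [/image_choice[x hx] ei _]].
have qi : indep (q \o x).
  move=> c h; apply: ei; rewrite -[RHS]h.
  by apply: eq_bigr => i _ /=; have [_ ->] := hx i.
exists x; split=> // [i|c h]; first by have [] := hx i.
apply: qi; have := pq (linsub_sum c hM (fun i => (hx i).1)).
by rewrite !linear_comb; apply.
Qed.

Lemma image_dim_leq n m : has_dim (p @` M) n -> has_dim (q @` M) m -> (m <= n)%N.
Proof.
move=> dp /image_dim_lift[x [xM _ pi]].
by apply: (has_dim_indep_leq dp pi) => i; exists (x i).
Qed.

(** If [p x] were nonzero while [q x = 0], adding [p x] to the lifted basis would
    give [n.+1] independent vectors in [p @` M]. *)
Lemma image_dim_inj n x : has_dim (p @` M) n -> has_dim (q @` M) n ->
  M x -> q x = 0 -> p x = 0.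
Proof.
move=> dp /image_dim_lift[y [yM qi pi]] Mx qx; apply: contrapT => /eqP px.
suff : (n.+1 <= n)%N by rewrite ltnn.
apply: (has_dim_indep_leq (u := family_cons (p x) (p \o y)) dp).
  apply: indep_cons => // a c h.
  have lin f (W' : lmodType K) (g : {linear U -> W'}) :
      g (a *: x + \sum_i c i *: f i) = a *: g x + \sum_i c i *: g (f i).
    by rewrite linearP linear_comb.
  have Mz : M (a *: x + \sum_i c i *: y i).
    by apply: linsubD => //; [exact: linsubZ|exact: linsub_sum].
  have := pq Mz; rewrite !lin qx scaler0 add0r => /(_ h) /qi c0.
  move: h; rewrite big1 => [|i _]; last by rewrite c0 scale0r.
  by rewrite addr0 => /eqP; rewrite scaler_eq0 (negPf px) orbF => /eqP.
move=> i; rewrite /family_cons; case: unlift => [j|] /=; first by exists (y j).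
by exists x.
Qed.

End TwoImages.
End Dimension.

(** * Graded subspaces *)

Section Graded.
Variable K : fieldType.

Lemma subsuper_parts (V : superspaceType K) (A : subsuper V) (x0 x1 : V) :
  homog false x0 -> homog true x1 -> A (x0 + x1) -> A x0 /\ A x1.
Proof.
move=> h0 h1 /subsuper_graded[y0 [y1 [A0 A1 k0 k1 e]]].
by have [-> ->] := homog_uniq h0 h1 k0 k1 e.
Qed.

Lemma subsuperI_graded (V : superspaceType K) (A B : subsuper V) x :
  (A `&` B) x -> exists x0 x1,
    [/\ (A `&` B) x0, (A `&` B) x1, homog false x0, homog true x1 & x = x0 + x1].
Proof.
have [x0 [x1 [h0 h1 ->]]] := homog_dec x; move=> [hA hB].
have [A0 A1] := subsuper_parts h0 h1 hA.
have [B0 B1] := subsuper_parts h0 h1 hB.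
by exists x0, x1.
Qed.

Definition subsuperI (V : superspaceType K) (A B : subsuper V) : subsuper V :=
  SubSuper (linsubI (subsuper_linsub A) (subsuper_linsub B))
    (@subsuperI_graded V A B).

Lemma subsuper_homog_eq (V : superspaceType K) (B : set V) (U : subsuper V) :
  is_linsub B -> (forall a x, U x -> homog a x -> B x) -> U `<=` B.
Proof.
move=> hB h x /subsuper_graded[x0 [x1 [U0 U1 h0 h1 ->]]].
by apply: linsubD => //; [exact: (h false)|exact: (h true)].
Qed.

(** An even map sends the components of a preimage to the components of the image,
    so a homogeneous image has a homogeneous preimage of the same parity. *)
Lemma image_homog (L M : lieSuperType K) (f : lieHom L M) (A : subsuper L) a :
  f @` A `&` homog a = f @` (A `&` homog a).
Proof.
apply/seteqP; split; last by move=> _ [x [Ax hx] <-]; split; [exists x|exact: lieHom_even].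
move=> _ [[x Ax <-] hfx].
have [x0 [x1 [A0 A1 h0 h1 e]]] := subsuper_graded Ax.
have [k0 k1] := (lieHom_even f h0, lieHom_even f h1).
have fx : f x = f x0 + f x1 by rewrite e linearD.
case: a hfx => hfx.
  exists x1 => //.
  have [|_ -> //] := homog_uniq (linsub0 (homog_linsub false)) hfx k0 k1.
  by rewrite add0r.
exists x0 => //.
have [|-> _ //] := homog_uniq hfx (linsub0 (homog_linsub true)) k0 k1.
by rewrite addr0.
Qed.

Section Kernel.
Variables (L M : lieSuperType K) (f : lieHom L M).

Lemma kernel_linsub : is_linsub [set x | f x = 0].
Proof.
split=> [|a x y /= fx fy]; first exact: linear0.
by rewrite linearP fx fy scaler0 addr0.
Qed.

Lemma kernel_graded x : [set x | f x = 0] x -> exists x0 x1,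
  [/\ [set x | f x = 0] x0, [set x | f x = 0] x1, homog false x0, homog true x1
    & x = x0 + x1].
Proof.
have [x0 [x1 [h0 h1 ->]]] := homog_dec x => /=; rewrite linearD => e.
have z a : homog a (0 : M) := linsub0 (homog_linsub a).
have [] := homog_uniq (lieHom_even f h0) (lieHom_even f h1) (z _) (z _).
  by rewrite addr0.
by exists x0, x1.
Qed.

Definition subkernel : subsuper L := SubSuper kernel_linsub kernel_graded.
End Kernel.

(** The inverse of an even bijection is even, because a preimage of a homogeneous
    element has one component sent to 0. *)
Lemma lieHom_inverse (L M : lieSuperType K) (f : lieHom L M) :
  bijective f -> exists g : lieHom M L, cancel f g /\ cancel g f.
Proof.
move=> [g fK gK].
have finj := can_inj fK.
have glin : linear g by move=> a x y; apply: finj; rewrite gK linearP !gK.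
pose gl : {linear M -> L} := HB.pack g (GRing.isLinear.Build K M L _ g glin).
have geven a x : homog a x -> homog a (gl x).
  move=> hx; have /= := image_homog f (subfull L) a.
  move/seteqP=> [/(_ x) h _]; case: h => [|y [_ hy] <-]; last by rewrite /= fK.
  by split=> //; exists (g x).
have gbrk x y : gl (brk x y) = brk (gl x) (gl y).
  by apply: finj; rewrite /= lieHom_brk !gK.
by exists (LieHom geven gbrk).
Qed.

(** By Zorn, [X] is a maximal graded subspace meeting [W] only inside [N];
    a homogeneous vector of [A] outside [W + X] could still be added to it. *)
Lemma graded_complement (V : superspaceType K) (N W A : subsuper V) :
  N `<=` W -> N `<=` A ->
  exists X : subsuper V, [/\ N `<=` X, X `<=` A, W `&` X `<=` N
    & forall x, A x -> exists w y, [/\ W w, X y & x = w + y]].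
Proof.
move=> NW NA.
pose good (Y : set V) := exists X : subsuper V,
  [/\ X = Y :> set V, N `<=` X, X `<=` A & W `&` X `<=` N].
(* The empty set is allowed because it is the union of the empty chain. *)
have [//|Y [hY Ymax]] := @Zorn_bigcup V [set Y | Y = set0 \/ good Y].
  move=> F FP Ftot.
  have [[Y0 FY0 gY0]|F0] := pselect (exists2 Y, F Y & good Y); last first.
    left; apply: bigcup0 => Y FY; case: (FP _ FY) => // gY.
    by case: F0; exists Y.
  have pick x : (\bigcup_(Y in F) Y) x -> exists X : subsuper V,
      [/\ F X, N `<=` X, X `<=` A, W `&` X `<=` N & X x].
    move=> [Y FY Yx]; case: (FP _ FY) => [Y00|[X [eX ? ? ?]]].
      by move: Yx; rewrite Y00.
    by exists X; split=> //; rewrite eX.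
  have sub Y : F Y -> Y `<=` \bigcup_(Y in F) Y by move=> FY x Yx; exists Y.
  have [X0 [e0 NX0 _ _]] := gY0; rewrite -e0 in FY0.
  have lin : is_linsub (\bigcup_(Y in F) Y).
    split; first by exists X0 => //; exact: (linsub0 (subsuper_linsub X0)).
    move=> a x y /pick[X [FX _ _ _ Xx]] /pick[X' [FX' _ _ _ Xy]].
    case: (Ftot _ _ FX FX') => le.
      exists X' => //; case: (subsuper_linsub X') => _; apply=> //; exact: le.
    by exists X => //; case: (subsuper_linsub X) => _; apply=> //; exact: le.
  have gr x : (\bigcup_(Y in F) Y) x -> exists x0 x1,
      [/\ (\bigcup_(Y in F) Y) x0, (\bigcup_(Y in F) Y) x1, homog false x0,
        homog true x1 & x = x0 + x1].
    move=> /pick[X [FX _ _ _ /subsuper_graded[x0 [x1 [X0x X1x h0 h1 e]]]]].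
    by exists x0, x1; split=> //; exists X.
  right; exists (SubSuper lin gr); split=> //=.
  - exact: (subset_trans NX0 (sub _ FY0)).
  - by move=> x /pick[X [_ _ XA _]] /XA.
  - by move=> x [Wx /pick[X [_ _ _ XN Xx]]]; exact: XN.
case: hY => [Y0|[X [eX NX XA XN]]].
  have gN : good N by exists N; split=> // x [].
  case: (Ymax N); last by right.
  by rewrite Y0; split=> // /(_ 0); apply; exact: (linsub0 (subsuper_linsub N)).
exists X; split=> //.
have lX := subsuper_linsub X; have lW := subsuper_linsub W.
pose S := [set x | exists w y, [/\ W w, X y & x = w + y]].
have lS : is_linsub S.
  split; first by exists 0, 0; rewrite addr0; split=> //; exact: linsub0.
  move=> a _ _ [w [y [Ww Xy ->]]] [w' [y' [Ww' Xy' ->]]].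
  exists (a *: w + w'), (a *: y + y'); rewrite scalerDr addrACA; split=> //.
    by case: lW => _; apply.
  by case: lX => _; apply.
apply: (@subsuper_homog_eq V S) => // a r Ar hr; apply: contrapT => Sr.
pose Z := [set x | exists y k, X y /\ x = y + k *: r].
have lZ : is_linsub Z.
  split; first by exists 0, 0; rewrite scale0r addr0; split=> //; exact: linsub0.
  move=> b _ _ [y [k [Xy ->]]] [y' [k' [Xy' ->]]].
  exists (b *: y + y'), (b * k + k'); split; first by case: lX => _; apply.
  by rewrite scalerDr scalerDl scalerA addrACA.
have gZ x : Z x -> exists x0 x1,
    [/\ Z x0, Z x1, homog false x0, homog true x1 & x = x0 + x1].
  move=> [y [k [/subsuper_graded[y0 [y1 [X0 X1 h0 h1 ->]]] ->]]].
  have ZX z : X z -> Z z by exists z, 0; rewrite scale0r addr0.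
  case: a hr => hr.
    exists y0, (y1 + k *: r); split; [exact: ZX|by exists y1, k|by []| |].
    - apply: (linsubD (homog_linsub true)) => //.
      exact: (linsubZ (homog_linsub true)).
    - by rewrite addrA.
  exists (y0 + k *: r), y1; split; [by exists y0, k|exact: ZX| |by []|].
  - apply: (linsubD (homog_linsub false)) => //.
    exact: (linsubZ (homog_linsub false)).
  - by rewrite addrAC.
have XZ : X `<=` Z by move=> y Xy; exists y, 0; rewrite scale0r addr0.
apply: (Ymax Z).
  rewrite -eX; split=> // ZX; apply: Sr.
  exists 0, r; rewrite add0r; split=> //; first exact: linsub0.
  apply: ZX; exists 0, 1; rewrite scale1r add0r; split=> //; exact: linsub0.
right; exists (SubSuper lZ gZ); split=> //=.
- exact: subset_trans NX XZ.
- move=> _ [y [k [/XA Ay ->]]]; apply: (linsubD (subsuper_linsub A)) => //.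
  exact: (linsubZ (subsuper_linsub A)).
- move=> x [Wx [y [k [Xy e]]]].
  have [k0|/eqP k0] := pselect (k = 0).
    by apply: XN; split=> //; rewrite e k0 scale0r addr0.
  case: Sr; exists (k^-1 *: x), (- (k^-1 *: y)); split.
  + exact: linsubZ.
  + by apply: linsubN => //; exact: linsubZ.
  + by rewrite -scalerBr e addrAC subrr add0r scalerA mulVf // scale1r.
Qed.

End Graded.

(** * Stem extensions *)

Section Stem.
Variables (K : fieldType) (L : lieSuperType K).
Implicit Types (E T : extension L).

Local Notation derived E := (subbrk (subfull (ext_mid E)) (subfull (ext_mid E))).
Local Notation commut E := (subbrk (ext_sub E) (subfull (ext_mid E))).

(** Modulo [commut E] this is the Schur multiplier of [L] when the middle term is free
    (Hopf's formula). *)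
Definition stem_part E : subsuper (ext_mid E) := subsuperI (ext_sub E) (derived E).

Lemma ext_subP E x : ext_sub E x <-> ext_proj E x = 0.
Proof. by split=> /ext_exact. Qed.

Lemma brkset_brk (M : lieSuperType K) (A B : set M) x y :
  A x -> B y -> brkset A B (brk x y).
Proof. by move=> Ax By C [_]; apply; exists x => //; exists y. Qed.

Lemma brkset_sub (M : lieSuperType K) (A B C : set M) : is_linsub C ->
  (forall x y, A x -> B y -> C (brk x y)) -> brkset A B `<=` C.
Proof. by move=> hC h x; apply; split=> // _ [u Au [v Bv <-]]; exact: h. Qed.

(** [centre] only asks that the bracket vanish with the central element on the left;
    for a graded subspace antisymmetry moves it to the right. *)
Lemma centre_brkr (M : lieSuperType K) (A : subsuper M) :
  A `<=` @centre K M -> forall x y, A y -> brk x y = 0.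
Proof.
move=> Az x y /subsuper_graded[y0 [y1 [/Az A0 /Az A1 k0 k1 ->]]].
have [x0 [x1 [h0 h1 ->]]] := homog_dec x.
rewrite brkDr !brkDl (brk_anti h0 k0) (brk_anti h1 k0).
by rewrite (brk_anti h0 k1) (brk_anti h1 k1) !A0 !A1 !scaler0 !oppr0 !addr0.
Qed.

Lemma central_brk_eq T u u' v v' : ext_sub T `<=` @centre K (ext_mid T) ->
  ext_proj T u = ext_proj T u' -> ext_proj T v = ext_proj T v' ->
  brk u v = brk u' v'.
Proof.
move=> Tz eu ev.
have sub x y : ext_proj T x = ext_proj T y -> ext_sub T (x - y).
  by move=> e; apply/ext_subP; rewrite linearB e subrr.
rewrite -[u](subrK u') brkDl (Tz _ (sub _ _ eu)) add0r.
by rewrite -[v](subrK v') brkDr (centre_brkr Tz _ (sub _ _ ev)) add0r.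
Qed.

(** The kernel term is a type of its own; dimensions are compared inside the middle
    terms. *)
Lemma has_dim_ext_ker E a n :
  has_dim (homog a : set (ext_ker E)) n <-> has_dim (ext_sub E `&` homog a) n.
Proof.
rewrite (has_dim_image _ _ (@ext_inj_injective _ _ E)).
by rewrite (image_homog (ext_inj E) (subfull _) a) setTI.
Qed.

(** Brackets in a central extension only depend on the images in [L], so lifts of a
    basis of [L] yield finitely many brackets spanning the derived algebra. *)
Lemma stem_has_sdim T : findim L -> is_stem T -> exists d, has_sdim (ext_ker T) d.
Proof.
move=> [n [e [_ _ es]]] [Tz Tb].
have [t ht] := choice (fun i => ext_proj_surj T (e i)).
pose b (ij : 'I_n * 'I_n) := brk (t ij.1) (t ij.2).
have bspan : brkset [set: ext_mid T] [set: ext_mid T] `<=` family_span b.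
  apply: (brkset_sub (family_span_linsub b)) => u v _ _.
  have [c hc] := es (ext_proj T u) I; have [d hd] := es (ext_proj T v) I.
  exists (fun ij => c ij.1 * d ij.2).
  rewrite (@central_brk_eq T _ (\sum_i c i *: t i) _ (\sum_i d i *: t i)) //.
  - rewrite (big_morph (fun x => brk x _) (fun x y => brkDl x y _) (brk0l _)).
    under eq_bigr => i _ do
      rewrite (big_morph (brk _) (brkDr _) (brk0r _)).
    rewrite pair_big; apply: eq_bigr => -[i j] _ /=.
    by rewrite brkZl brkZr scalerA.
  - by rewrite hc linear_comb; apply: eq_bigr => i _; rewrite ht.
  - by rewrite hd linear_comb; apply: eq_bigr => i _; rewrite ht.
have dim a : exists m, has_dim (homog a : set (ext_ker T)) m.
  have [|x [/Tb /bspan //]|m hm] := @has_dim_finspan K _ (ext_sub T `&` homog a) _ b.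
    exact: linsubI (subsuper_linsub _) (homog_linsub a).
  by exists m; apply/has_dim_ext_ker.
have [[m0 h0] [m1 h1]] := (dim false, dim true).
by exists (m0, m1).
Qed.

Section HomToStem.
Variables (E T : extension L) (f : lieHom (ext_mid E) (ext_mid T)).
Hypotheses (hf : is_ext_hom f) (hT : is_stem T).

(** A bracket of [T] equals the bracket of the images of two elements of [E] lying over
    the same elements of [L]; so the derived algebra of [T], and with it the kernel of
    [T], consists of images of elements of the derived algebra of [E]. *)
Lemma stem_kernel_image : f @` stem_part E = ext_sub T.
Proof.
have [Tz Tb] := hT; apply/seteqP; split=> [_ [x [/ext_subP Ex _] <-]|s Ts].
  by apply/ext_subP; rewrite hf.
have : brkset [set: ext_mid T] [set: ext_mid T] `<=` f @` derived E.
  apply: brkset_sub; first exact: (linsub_image f (subsuper_linsub (derived E))).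
  move=> u v _ _.
  have [[x ex] [y ey]] := (ext_proj_surj E (ext_proj T u), ext_proj_surj E (ext_proj T v)).
  exists (brk x y); first exact: brkset_brk.
  by rewrite lieHom_brk; apply: central_brk_eq => //; rewrite hf.
move=> /(_ _ (Tb _ Ts))[x Dx e]; exists x => //; split=> //.
by apply/ext_subP; rewrite -hf e; apply/ext_subP.
Qed.

Lemma stem_hom_surj t : exists x, f x = t.
Proof.
have [y ey] := ext_proj_surj E (ext_proj T t).
have : ext_sub T (t - f y) by apply/ext_subP; rewrite linearB hf ey subrr.
rewrite -stem_kernel_image => -[x _ e].
by exists (x + y); rewrite linearD e subrK.
Qed.

Lemma stem_hom_commut0 x : commut E x -> f x = 0.
Proof.
apply: (brkset_sub (kernel_linsub f)) => u v /ext_subP Eu _ /=.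
by rewrite lieHom_brk; have [+ _] := hT; apply; apply/ext_subP; rewrite hf.
Qed.

End HomToStem.

(** Applied to the projection onto a stem deformation as well as to a lift into an
    arbitrary stem extension, so that both kernels are images of [stem_part E]. *)
Lemma stem_part_image_homog E T (f : lieHom (ext_mid E) (ext_mid T)) a n :
  is_ext_hom f -> is_stem T ->
  has_dim (homog a : set (ext_ker T)) n <-> has_dim (f @` (stem_part E `&` homog a)) n.
Proof. by move=> hf hT; rewrite has_dim_ext_ker -(stem_kernel_image hf hT) image_homog. Qed.

Section Compare.
Variables (E T1 T2 : extension L).
Variables (f1 : lieHom (ext_mid E) (ext_mid T1)) (f2 : lieHom (ext_mid E) (ext_mid T2)).
Hypotheses (hf1 : is_ext_hom f1) (hf2 : is_ext_hom f2).
Hypotheses (hT1 : is_stem T1) (hT2 : is_stem T2).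
Hypothesis f12 : forall x, stem_part E x -> f1 x = 0 -> f2 x = 0.

Let f12_homog a x : (stem_part E `&` homog a) x -> f1 x = 0 -> f2 x = 0.
Proof. by move=> [/f12]. Qed.

Let part_linsub a : is_linsub (stem_part E `&` homog a).
Proof. exact: linsubI (subsuper_linsub _) (homog_linsub a). Qed.

Lemma stem_sdim_le d1 d2 :
  has_sdim (ext_ker T1) d1 -> has_sdim (ext_ker T2) d2 -> sdim_le d2 d1.
Proof.
rewrite /has_sdim !(stem_part_image_homog _ _ hf1 hT1) => -[d10 d11].
rewrite !(stem_part_image_homog _ _ hf2 hT2) => -[d20 d21].
by apply/andP; split;
  [exact: (image_dim_leq (@part_linsub _) (@f12_homog _) d10 d20)
  |exact: (image_dim_leq (@part_linsub _) (@f12_homog _) d11 d21)].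
Qed.

Lemma stem_sdim_inj d : has_sdim (ext_ker T1) d -> has_sdim (ext_ker T2) d ->
  forall x, stem_part E x -> f2 x = 0 -> f1 x = 0.
Proof.
rewrite /has_sdim !(stem_part_image_homog _ _ hf1 hT1) => -[d10 d11].
rewrite !(stem_part_image_homog _ _ hf2 hT2) => -[d20 d21].
suff : subsuperI (stem_part E) (subkernel f2) `<=` [set x | f1 x = 0].
  by move=> h x Ex fx; apply: h.
apply: subsuper_homog_eq; first exact: kernel_linsub.
case=> x [Ex fx] hx /=.
  exact: (image_dim_inj (part_linsub true) (@f12_homog _) d11 d21).
exact: (image_dim_inj (part_linsub false) (@f12_homog _) d10 d20).
Qed.

End Compare.

(** * Stem denominators *)

(** The direct sum decomposition, pulled back from the quotient by [commut E]. *)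
Lemma stem_denominatorP E (X : subsuper (ext_mid E)) :
  stem_denominator X <->
  [/\ commut E `<=` X, X `<=` ext_sub E, stem_part E `&` X `<=` commut E
    & forall x, ext_sub E x -> exists w y, [/\ stem_part E w, X y & x = w + y]].
Proof.
have lC := subsuper_linsub (commut E); have lX := subsuper_linsub X.
have lA := subsuper_linsub (ext_sub E).
split=> [[CX XA [hsum hcap]]|[CX XA hcap hsum]]; split=> //.
- move=> x [Wx Xx]; move/seteqP: hcap => [/(_ (qpi _ x)) + _].
  move=> /(_ (conj (imageP _ Wx) (imageP _ Xx))).
  by rewrite /= -qpi0 => /qpi_eq; rewrite subr0.
- move=> x Ax; move/seteqP: hsum => [/(_ (qpi _ x)) + _].
  move=> /(_ (imageP _ Ax))[_ [w Ww <-] [_ [y Xy <-]]].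
  rewrite -qpiD => /esym/qpi_eq h.
  exists w, (x - w); split=> //; last by rewrite addrC subrK.
  rewrite (_ : x - w = x - (w + y) + y); last by rewrite opprD addrA subrK.
  by apply: linsubD => //; exact: CX.
split; apply/seteqP; split.
- move=> _ [x /hsum[w [y [Ww Xy ->]]] <-].
  exists (qpi _ w); first exact: imageP.
  by exists (qpi _ y); [exact: imageP|rewrite qpiD].
- move=> _ [_ [w [Aw _] <-] [_ [y /XA Ay <-] <-]].
  by rewrite -qpiD; apply: imageP; exact: linsubD.
- move=> _ [[w Ww <-] [y Xy /esym/qpi_eq h]]; rewrite /= -qpi0; apply/qpi_eq.
  rewrite subr0; apply: hcap; split=> //.
  by rewrite -[w](subrK y); apply: linsubD => //; exact: CX.
- move=> _ ->; split; exists 0; rewrite ?qpi0 //.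
    exact: (linsub0 (subsuper_linsub (stem_part E))).
  exact: linsub0.
Qed.

Lemma commut_stem_part E : commut E `<=` stem_part E.
Proof.
apply: brkset_sub; first exact: subsuper_linsub.
move=> x y /ext_subP Ex _; split; last exact: brkset_brk.
by apply/ext_subP; rewrite lieHom_brk Ex brk0l.
Qed.

Lemma stem_denominator_exists E : exists X : subsuper (ext_mid E), stem_denominator X.
Proof.
have CW := @commut_stem_part E.
have [|X [? ? ? ?]] := graded_complement CW (A := ext_sub E).
  by move=> x /CW[].
by exists X; apply/stem_denominatorP.
Qed.

Section Deformation.
Variables (E : extension L) (X : subsuper (ext_mid E)) (hX : stem_denominator X).

Let p : lieHom (ext_mid E) (ext_mid (stem_deformation hX)) := lquot_pi (stem_ideal hX).

Lemma deform_pi_hom : is_ext_hom p.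
Proof. by move=> x; exact: (lquot_liftE (@deform_proj0 _ _ _ _ hX)). Qed.

Lemma deform_pi_eq0 x : p x = 0 <-> X x.
Proof.
rewrite -[X in _ = X](linear0 p); split=> [/lpi_eq|h]; first by rewrite subr0.
by apply/lpi_eq; rewrite subr0.
Qed.

Lemma deform_sub u : ext_sub (stem_deformation hX) u ->
  exists w, [/\ stem_part E w & p w = u].
Proof.
move=> /ext_subP; have [x <-] := lpi_surj u.
rewrite (deform_pi_hom x) => /ext_subP Ex.
have /stem_denominatorP[_ _ _ /(_ _ Ex)[w [y [Ww Xy ->]]]] := hX.
exists w; split=> //; rewrite [RHS](linearD p w y).
by rewrite (deform_pi_eq0 y).2 // addr0.
Qed.

(** The kernel is central because [X] contains [commut E]. It lies in the derived
    algebra because [X] and [stem_part E] span [ext_sub E], so that each class of the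
    kernel has a representative in [stem_part E]. *)
Lemma stem_deformation_stem : is_stem (stem_deformation hX).
Proof.
split=> u /deform_sub[w [[Ew Dw] <-]].
  move=> v; have [y <-] := lpi_surj v; rewrite -[brk _ _](lieHom_brk p w y).
  apply/deform_pi_eq0; have /stem_denominatorP[CX _ _ _] := hX.
  by apply: CX; exact: brkset_brk.
have : derived E `<=` p @^-1` (derived (stem_deformation hX)).
  apply: brkset_sub.
    have [D0 hD] := subsuper_linsub (derived (stem_deformation hX)).
    split; first by rewrite /preimage /= linear0.
    by move=> a x y hx hy; rewrite /preimage /= linearP; apply: hD.
  move=> x y _ _; change (derived (stem_deformation hX) (p (brk x y))).
  by rewrite lieHom_brk; exact: brkset_brk.
exact.
Qed.

(** An element of [stem_part E] killed by [p] lies in [X], hence in [commut E]. *)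
Lemma stem_hom_deform_pi T (f : lieHom (ext_mid E) (ext_mid T)) :
  is_ext_hom f -> is_stem T -> forall x, stem_part E x -> p x = 0 -> f x = 0.
Proof.
move=> hf hT x Wx /deform_pi_eq0 Xx; apply: (stem_hom_commut0 hf hT).
by have /stem_denominatorP[_ _ h _] := hX; apply: h.
Qed.

End Deformation.

(** [f] is onto because its image contains the kernel of [T] and covers [L], so the
    first isomorphism theorem applies. *)
Lemma stem_hom_kernel_iso E T (f : lieHom (ext_mid E) (ext_mid T))
    (hX : stem_denominator (subkernel f)) :
  is_ext_hom f -> is_stem T -> ext_iso T (stem_deformation hX).
Proof.
move=> hf hT; have f0 x : stem_ideal hX x -> f x = 0 by [].
pose g : lieHom (ext_mid (stem_deformation hX)) (ext_mid T) := lquot_lift f0.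
have gE x : g (lpi _ x) = f x by exact: (lquot_liftE f0).
have ginj : injective g.
  move=> u v; have [x <-] := lpi_surj u; have [y <-] := lpi_surj v.
  by rewrite !gE => e; apply/lpi_eq; rewrite /= linearB e subrr.
have [h hh] := choice (stem_hom_surj hf hT).
have gbij : bijective g.
  exists (fun t => lpi (stem_ideal hX) (h t)) => [u|t]; last by rewrite gE hh.
  by apply: ginj; rewrite gE hh.
have [k [gk kg]] := lieHom_inverse gbij.
exists k; split; last by exists g.
move=> t; have [x <-] := stem_hom_surj hf hT t.
by rewrite -gE gk gE hf; exact: deform_pi_hom.
Qed.

(** Generators go to homogeneous lifts of their images in [L]; the uniqueness clause of
    freeness over [L] shows that the resulting map covers the identity of [L]. *)
Lemma free_ext_lift E T : is_free_lie (ext_mid E) ->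
  exists f : lieHom (ext_mid E) (ext_mid T), is_ext_hom f.
Proof.
move=> [X [par [i [hi univ]]]].
have lift x : exists t, homog (par x) t /\ ext_proj T t = ext_proj E (i x).
  have /seteqP[/(_ (ext_proj E (i x))) + _] :=
    image_homog (ext_proj T) (subfull _) (par x).
  case; first by split; [have [t] := ext_proj_surj T (ext_proj E (i x)); exists t
                        |exact/lieHom_even/hi].
  by move=> t [_ ht] e; exists t.
have [g hg] := choice lift.
have [[f ff] _] := univ (ext_mid T) g (fun x => (hg x).1).
exists f => x.
have [_ uniq] := univ L (ext_proj E \o i) (fun x => lieHom_even _ (hi x)).
apply: (uniq (lieComp (ext_proj T) f) (ext_proj E)) => //= y.
by rewrite ff; have [] := hg y.
Qed.

End Stem.

Theorem theorem2p7 (K : fieldType)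
    (hK2 : 2%N \notin [pchar K]%R) (hK3 : 3%N \notin [pchar K]%R)
    (L : lieSuperType K) (hL : findim L)
    (E : extension L) (hE : is_free_lie (ext_mid E)) :
  (forall (X : subsuper (ext_mid E)) (hX : stem_denominator X),
     is_maximal_stem (stem_deformation hX)) /\
  (forall T : extension L, is_maximal_stem T ->
     exists (X : subsuper (ext_mid E)) (hX : stem_denominator X),
       ext_iso T (stem_deformation hX)).
Proof.
split=> [X hX|T [hT [d [dT dmax]]]].
  have hS := stem_deformation_stem hX.
  have [d dX] := stem_has_sdim hL hS.
  split=> //; exists d; split=> // T d' hT dT /andP[le1 le2].
  have [f hf] := free_ext_lift T hE.
  have /andP[ge1 ge2] := stem_sdim_le (deform_pi_hom hX) hf hS hT
    (stem_hom_deform_pi hf hT) dX dT.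
  rewrite [d]surjective_pairing [d']surjective_pairing.
  by congr pair; apply/eqP; rewrite eqn_leq ?ge1 ?ge2.
have [f hf] := free_ext_lift T hE.
have [X hX] := stem_denominator_exists E.
have hS := stem_deformation_stem hX.
have [d' dX] := stem_has_sdim hL hS.
have fX := stem_hom_deform_pi (hX := hX) hf hT.
(* Maximality of [T] is used against the stem deformation by an arbitrary [X]. *)
have ed : d' = d.
  apply: (dmax _ _ hS dX).
  exact: (stem_sdim_le (deform_pi_hom hX) hf hS hT fX dX dT).
rewrite ed in dX.
have finj := stem_sdim_inj (deform_pi_hom hX) hf hS hT fX dX dT.
have hker : stem_denominator (subkernel f).
  apply/stem_denominatorP; split.
  - exact: (stem_hom_commut0 hf hT).
  - by move=> x /= fx; apply/ext_subP; rewrite -hf fx linear0.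
  - move=> x [Wx fx]; have /stem_denominatorP[_ _ cap _] := hX.
    by apply: cap; split=> //; apply/deform_pi_eq0; exact: finj.
  - move=> x /ext_subP Ex; have : ext_sub T (f x) by apply/ext_subP; rewrite hf.
    rewrite -(stem_kernel_image hf hT) => -[w Ww e].
    exists w, (x - w); split=> //=; first by rewrite linearB e subrr.
    by rewrite addrC subrK.
by exists (subkernel f), hker; exact: stem_hom_kernel_iso.
Qed.
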